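(* Let $G$ be a connected Deza graph with parameters $(v,k,k-2,a)$. Then either $a\in\{k-3,k-4\}$ or $G$ is a divisible design graph. Moreover: 1. If $G$ has parameters $(v,k,k-2,k-3)$, then one of the following cases holds: (i) $G$ is a strictly Deza graph with parameters $(8,4,2,1)$ or $(9,4,2,1)$; (ii) $G$ is a strongly regular graph with parameters $(9,4,1,2)$, $(10,3,0,1)$ or $(10,6,3,4)$; (iii) $G$ has parameters $(v,3,1,0)$ and diameter more than $2$. 2. If $G$ has parameters $(v,k,k-2,k-4)$, then one of the following cases holds: (i) $G$ is isomorphic to the complement of the disjoint union of $s$ cubes $H(3,2)$ for some positive integer $s$, and it has parameters $(8s,\,8(s-1)+4,\,8(s-1)+2,\,8(s-1))$; (ii) $G$ is a Deza graph with parameters $(14,4,2,0)$ and it is isomorphic to the non-incidence graph of the Fano plane; (iii) $G$ is isomorphic to the four-dimensional cube $H(4,2)$, with parameters $(16,4,2,0)$.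
   Context: All graphs are finite, undirected, without loops and multiple edges. A Deza graph with parameters $(v,k,b,a)$, $a\le b$, is a $k$-regular graph on $v$ vertices in which the number of common neighbors of two distinct vertices takes the two values $a$ and $b$, and both cases occur. A strictly Deza graph is a Deza graph of diameter $2$ that is not strongly regular. Strongly regular graphs have parameters $(v,k,\lambda,\mu)$, where any two adjacent vertices have exactly $\lambda$ common neighbors and any two distinct non-adjacent vertices have exactly $\mu$ common neighbors. A $k$-regular graph on $v$ vertices is a divisible design graph with parameters $(v,k,\lambda_1,\lambda_2,m,n)$ if its vertex set can be partitioned into $m$ classes of size $n$ such that two distinct vertices from the same class have exactly $\lambda_1$ common neighbors and two vertices from different classes have exactly $\lambda_2$ common neighbors. $H(d,2)$ is the graph on $\{0,1\}^d$ in which two vertices are adjacent iff they differ in exactly one coordinate. The non-incidence graph of the Fano plane is the bipartite graph on its 7 points and 7 lines in which a point is adjacent to a line iff the point does not lie on the line. *)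

(* Defs.v *)
From mathcomp Require Import all_boot all_order all_algebra.

Set Implicit Arguments.
Unset Strict Implicit.
Unset Printing Implicit Defensive.

Record sgraph := SGraph {
  svertex :> finType;
  sedge : rel svertex;
  sedge_sym : symmetric sedge;
  sedge_irr : irreflexive sedge
}.

Section GraphTheory.

Variable G : sgraph.
Implicit Types x y : G.

Definition neighbors x : {set G} := [set z | sedge x z].

Definition common_neighbors x y : nat := #|neighbors x :&: neighbors y|.

Definition regular (k : nat) : Prop := forall x, #|neighbors x| = k.

Definition connected : Prop := forall x y, connect (@sedge G) x y.

Definition walk_of_length (n : nat) x y : bool :=
  [exists p : n.-tuple G, path (@sedge G) x p && (last x p == y)].

(* The length of a shortest walk from x to y; a shortest walk has fewer than
   #|G| edges, and the value #|G| stands for infinity (no walk). *)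
Definition gdist x y : nat :=
  find (fun n => walk_of_length n x y) (iota 0 #|G|).

Definition diameter : nat := \max_(x : G) \max_(y : G) gdist x y.

Definition strongly_regular (v k l mu : nat) : Prop :=
  [/\ #|G| = v,
      regular k,
      forall x y, sedge x y -> common_neighbors x y = l
    & forall x y, x != y -> ~~ sedge x y -> common_neighbors x y = mu].

Definition is_strongly_regular : Prop :=
  exists v k l mu, strongly_regular v k l mu.

Definition deza (v k b a : nat) : Prop :=
  [/\ #|G| = v /\ regular k,
      a <= b,
      forall x y, x != y -> common_neighbors x y = a \/ common_neighbors x y = b,
      exists x y, x != y /\ common_neighbors x y = a
    & exists x y, x != y /\ common_neighbors x y = b].

(* Connectedness is part of having diameter 2: it makes gdist the genuine
   distance. *)
Definition strictly_deza (v k b a : nat) : Prop :=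
  [/\ deza v k b a, connected, diameter = 2 & ~ is_strongly_regular].

Definition divisible_design (v k l1 l2 m n : nat) : Prop :=
  [/\ #|G| = v, regular k
    & exists P : {set {set G}},
        [/\ partition P [set: G],
            #|P| = m,
            forall C, C \in P -> #|C| = n,
            forall C x y, C \in P -> x \in C -> y \in C -> x != y ->
              common_neighbors x y = l1
          & forall C D x y, C \in P -> D \in P -> C != D ->
              x \in C -> y \in D -> common_neighbors x y = l2]].

Definition is_divisible_design : Prop :=
  exists v k l1 l2 m n, divisible_design v k l1 l2 m n.

End GraphTheory.

Definition isomorphic (G H : sgraph) : Prop :=
  exists2 f : G -> H, bijective f
    & forall x y, sedge (f x) (f y) = sedge x y.

Section Complement.

Variable G : sgraph.

Definition compl_edge : rel G := fun x y => (x != y) && ~~ sedge x y.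

Fact compl_sym : symmetric compl_edge.
Proof. by move=> x y; rewrite /compl_edge eq_sym sedge_sym. Qed.

Fact compl_irr : irreflexive compl_edge.
Proof. by move=> x; rewrite /compl_edge eqxx. Qed.

Definition complement : sgraph := SGraph compl_sym compl_irr.

End Complement.

Section Copies.

Variables (s : nat) (G : sgraph).

Definition copies_edge : rel ('I_s * G)%type :=
  fun x y => (x.1 == y.1) && sedge x.2 y.2.

Fact copies_sym : symmetric copies_edge.
Proof. by move=> x y; rewrite /copies_edge eq_sym sedge_sym. Qed.

Fact copies_irr : irreflexive copies_edge.
Proof. by move=> x; rewrite /copies_edge sedge_irr andbF. Qed.

(* The disjoint union of s copies of G. *)
Definition copies : sgraph := SGraph copies_sym copies_irr.

End Copies.

Section Hypercube.

Variable d : nat.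

Definition cube_edge : rel {ffun 'I_d -> bool} :=
  fun x y => #|[set i | x i != y i]| == 1.

Fact cube_sym : symmetric cube_edge.
Proof.
move=> x y; rewrite /cube_edge; congr (_ == _); apply: eq_card => i.
by rewrite !inE eq_sym.
Qed.

Fact cube_irr : irreflexive cube_edge.
Proof.
move=> x; rewrite /cube_edge; suff -> : [set i | x i != x i] = set0.
  by rewrite cards0.
by apply/setP => i; rewrite !inE eqxx.
Qed.

(* The graph H(d,2). *)
Definition hypercube : sgraph := SGraph cube_sym cube_irr.

End Hypercube.

(* The Fano plane from the perfect difference set {0,1,3} modulo 7: the points
   are the residues modulo 7 and line j consists of j, j+1 and j+3. *)
Definition fano_line (j : 'Z_7) : {set 'Z_7} := [set j; j + 1; j + 3]%R.

Definition fano_nonincidence_edge : rel ('Z_7 + 'Z_7)%type :=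
  fun x y => match x, y with
  | inl p, inr j | inr j, inl p => p \notin fano_line j
  | _, _ => false
  end.

Fact fano_nonincidence_sym : symmetric fano_nonincidence_edge.
Proof. by case=> x [] y. Qed.

Fact fano_nonincidence_irr : irreflexive fano_nonincidence_edge.
Proof. by case. Qed.

(* Left vertices are the points and right vertices the lines. *)
Definition fano_nonincidence : sgraph :=
  SGraph fano_nonincidence_sym fano_nonincidence_irr.

(* Main.v *)
Require Import Defs.
From mathcomp Require Import all_boot all_order all_algebra.
From mathcomp Require Import zify.

(* Let c = k - a, so that |N(x) \ N(y)| is 2 or c for distinct x, y.  By the
   triangle inequality for |N(x) \ N(y)|, having b common neighbours (being
   partners) is an equivalence relation when c > 4, and the classes have equal
   sizes because the number beta of partners of a vertex is determined by
   counting walks of length 2.  Write v = k + d; then the same count reads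
   (d - 3)(k - 3) + beta = 6 for c = 3 and (d - 4)(k - 4) + 2 beta = 12 for
   c = 4.  Moreover d >= 4, since in the complement the closed neighbourhoods
   of adjacent vertices meet in |N(x) & N(y)| + d - k >= 2 elements.  So d = 4,
   or k is the least possible, or only finitely many degrees remain.  Cubic
   graphs with c = 3 and v > 8 are settled by counting the vertices at distance
   at most 2, and for c = 3, d = 4 and k > 4 the non-neighbours of a vertex are
   partners of it, so that k <= 6, and k = 6 gives the last strongly regular
   graph.  In the other cases the graph or its complement has a small degree and
   prescribed numbers of common neighbours, and its components are enumerated
   by an exhaustive search which is proved correct and then run. *)

Set Implicit Arguments.
Unset Strict Implicit.
Unset Printing Implicit Defensive.

(** * Lists and connectivity *)

Lemma all2_filter (S T : Type) (R : S -> T -> bool) (p : pred S) (q : pred T)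
    (s : seq S) (t : seq T) :
  (forall x y, R x y -> p x = q y) -> all2 R s t ->
  all2 R (filter p s) (filter q t).
Proof.
move=> Rpq; elim: s t => [|x s IH] [|y t] //= /andP[Rxy st].
by rewrite -(Rpq _ _ Rxy); case: (p x) => /=; rewrite ?Rxy IH.
Qed.

Lemma all2_cat (S T : Type) (R : S -> T -> bool) s1 s2 t1 t2 :
  all2 R s1 t1 -> all2 R s2 t2 -> all2 R (s1 ++ s2) (t1 ++ t2).
Proof. by elim: s1 t1 => [|x s IH] [|y t] //= /andP[-> /IH] h /h. Qed.

Lemma flatten_filter_nonempty (T : eqType) (ls : seq (seq T)) :
  flatten [seq l <- ls | size l != 0] = flatten ls.
Proof. by elim: ls => //= -[|x l] ls /= ->. Qed.

Lemma connect_symmetric (G : sgraph) : connect_sym (@sedge G).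
Proof. exact/sym_connect_sym/sedge_sym. Qed.

Lemma closed_component (G : sgraph) (ys : seq G) (x y : G) :
  x \in ys -> (forall y z, y \in ys -> sedge y z -> z \in ys) ->
  connect (@sedge G) x y -> y \in ys.
Proof.
move=> x_ys closed_ys xy.
have closed_ys' : closed (@sedge G) (mem ys).
  apply: (intro_closed (@connect_symmetric G)) => z w zw z_ys.
  exact: closed_ys z_ys zw.
by move: (closed_connect closed_ys' xy); rewrite /= x_ys => <-.
Qed.

(** * Exhaustive search for a component of a graph *)

Section ComponentSearch.

Variables (k : nat) (adj nonadj : seq nat).
Variable leaf : seq (seq bool) -> bool.

(* A state of the search is the adjacency matrix [M] of the visited vertices,
   latest first, together with a list of cells.  A cell [(s, n)] stands for the
   [n] unvisited vertices whose adjacencies to the visited ones are given by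
   [s]; vertices without visited neighbours belong to no cell.  Visiting a
   vertex of the first cell splits every cell according to adjacency to it, so
   a branch is determined by the list [ms] of the numbers of its neighbours in
   the cells. *)
Definition cell : Type := seq bool * nat.

(** The sum of [ms] may fall short of [need]: the missing neighbours lie in no cell yet and form a
    new one in [next_cells]. *)
Fixpoint splits (cells : seq cell) (need : nat) : seq (seq nat) :=
  if cells is c :: cells' then
    flatten [seq [seq m :: ms | ms <- splits cells' (need - m)]
            | m <- iota 0 (minn c.2 need).+1]
  else [:: [::]].

(** First the visited common neighbours with the [j]-th visited vertex, then those in the cells;
    vertices in no cell are not adjacent to it. *)
Definition codegree (M : seq (seq bool)) (s : seq bool) (cells : seq cell)
    (ms : seq nat) (j : nat) : nat :=
  count (fun p => p.1 && nth false p.2 j) (zip s M)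
  + sumn [seq (nth false p.1.1 j) * p.2 | p <- zip cells ms].

Definition admissible M s cells ms : bool :=
  (count id s <= k) &&
  all (fun j => codegree M s cells ms j
                  \in if nth false s j then adj else nonadj)
      (iota 0 (size s)).

Definition next_matrix (M : seq (seq bool)) (s : seq bool) : seq (seq bool) :=
  (false :: s) :: [seq p.1 :: p.2 | p <- zip s M].

Definition next_cells (s : seq bool) (cells : seq cell) (ms : seq nat) :
    seq cell :=
  [seq c <- flatten [seq [:: (true :: p.1.1, p.2);
                             (false :: p.1.1, p.1.2 - p.2)]
                    | p <- zip cells ms]
            ++ [:: (true :: nseq (size s) false, k - count id s - sumn ms)]
  | c.2 != 0].

(** Vertices of one cell look alike from the visited ones, so any of them may come next. Lack of
    fuel gives [false], so [true] certifies that every branch dies or ends in a matrix accepted by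
    [leaf]. *)
Fixpoint search (fuel : nat) (M : seq (seq bool)) (cells : seq cell) : bool :=
  if fuel is fuel'.+1 then
    match cells with
    | [::] => leaf M
    | (_, 0) :: cells' => search fuel' M cells'
    | (s, n.+1) :: cells' =>
      let rest := (s, n) :: cells' in
      all (fun ms => search fuel' (next_matrix M s) (next_cells s rest ms))
          [seq ms <- splits rest (k - count id s) | admissible M s rest ms]
    end
  else false.

Variable G : sgraph.
Hypothesis G_regular : regular G k.
Hypothesis G_codegrees : forall x y : G, x != y ->
  common_neighbors x y \in if sedge x y then adj else nonadj.

Definition adjrow (xs : seq G) (y : G) : seq bool := [seq sedge y x | x <- xs].

Definition adjmat (xs : seq G) : seq (seq bool) := [seq adjrow xs x | x <- xs].

Definition represents (xs : seq G) (c : cell) (l : seq G) : bool :=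
  (size l == c.2) && all (fun y => adjrow xs y == c.1) l.

(** The invariant tying a state to [G], with the members of the cells in [ls]. Its last clause makes
    the visited vertices a whole component once no cell is left. *)
Definition explored (x0 : G) (xs : seq G) (cells : seq cell)
    (ls : seq (seq G)) : Prop :=
  [/\ uniq (xs ++ flatten ls), all2 (represents xs) cells ls,
      {subset xs ++ flatten ls <= connect (@sedge G) x0}
    & forall y, y \notin xs ++ flatten ls ->
        adjrow xs y = nseq (size xs) false].

Lemma neighbors_count (y : G) (zs : seq G) (P : pred G) :
  uniq zs -> (forall z, sedge y z -> P z -> z \in zs) ->
  #|[set z in neighbors y | P z]| = count (fun z => sedge y z && P z) zs.
Proof.
move=> zs_uniq zsP; rewrite -size_filter.
rewrite -(card_uniqP _); last exact: filter_uniq.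
apply: eq_card => z; rewrite !inE mem_filter.
by case e_yz: (sedge y z) => //=; case Pz: (P z) => //=; rewrite zsP.
Qed.

Lemma mem_splits (cells : seq cell) (need : nat) (ms : seq nat) :
  all2 (fun c m => m <= c.2) cells ms -> sumn ms <= need ->
  ms \in splits cells need.
Proof.
elim: cells need ms => [|c cells IH] need [|m ms] //.
rewrite [sumn _]/= => /andP[m_c ms_cells] le.
apply/flattenP; exists [seq m :: ms' | ms' <- splits cells (need - m)].
  by apply/mapP; exists m => //; rewrite mem_iota; lia.
by apply/mapP; exists ms => //; apply: IH => //; lia.
Qed.

#[local] Arguments splits : simpl never.

Lemma all2_count_le (p : pred G) (xs : seq G) cells (ls : seq (seq G)) :
  all2 (represents xs) cells ls ->
  all2 (fun c m => m <= c.2) cells [seq count p l | l <- ls].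
Proof.
elim: cells ls => [|c cells IH] [|l ls] //= /andP[/andP[/eqP <- _] /IH ->].
by rewrite count_size.
Qed.

Lemma codegree_cells (x0 y : G) (xs : seq G) cells (ls : seq (seq G))
    (j : nat) :
  j < size xs -> all2 (represents xs) cells ls ->
  sumn [seq (nth false p.1.1 j) * p.2
       | p <- zip cells [seq count (sedge y) l | l <- ls]]
  = count (fun z => sedge y z && sedge (nth x0 xs j) z) (flatten ls).
Proof.
move=> j_xs; elim: cells ls => [|c cells IH] [|l ls] //=.
case/andP=> /andP[_ /allP row_l] /IH ->.
rewrite count_cat; congr addn.
have rowE z : z \in l -> sedge (nth x0 xs j) z = nth false c.1 j.
  by move=> /row_l /eqP <-; rewrite (nth_map x0) // sedge_sym.
case c_j: (nth false c.1 j); rewrite ?mul1n ?mul0n.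
  by apply: eq_in_count => z /rowE ->; rewrite c_j andbT.
by apply/esym/eqP; rewrite -leqn0 leqNgt -has_count; apply/hasPn => z /rowE ->;
  rewrite c_j andbF.
Qed.

Lemma all2_represents_split (y : G) (xs : seq G) cells (ls : seq (seq G)) :
  all2 (represents xs) cells ls ->
  all2 (represents (y :: xs))
    (flatten [seq [:: (true :: p.1.1, p.2); (false :: p.1.1, p.1.2 - p.2)]
             | p <- zip cells [seq count (sedge y) l | l <- ls]])
    (flatten [seq [:: [seq z <- l | sedge y z]; [seq z <- l | ~~ sedge y z]]
             | l <- ls]).
Proof.
elim: cells ls => [|c cells IH] [|l ls] //=.
case/andP=> /andP[/eqP size_l /allP row_l] /IH ->.
rewrite andbT /represents !size_filter eqxx -size_l /=.
have -> : count (fun z => ~~ sedge y z) l == size l - count (sedge y) l.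
  by rewrite -(count_predC (sedge y) l) addKn.
apply/andP; split; apply/allP => z.
  all: rewrite mem_filter => /andP[yz /row_l /eqP <-].
  by rewrite sedge_sym yz.
by rewrite sedge_sym (negbTE yz).
Qed.

Lemma flatten_split (y : G) (ls : seq (seq G)) :
  perm_eq (flatten (flatten [seq [:: [seq z <- l | sedge y z];
                                     [seq z <- l | ~~ sedge y z]] | l <- ls]))
          (flatten ls).
Proof.
elim: ls => //= l ls IH; rewrite catA; apply: perm_cat IH.
by rewrite perm_filterC.
Qed.

(** [G] itself selects a branch: [ms] counts the neighbours of [y] in the cells, and is admissible
    by regularity and the prescribed codegrees. *)
Lemma search_step (x0 : G) (xs : seq G) (s : seq bool) (n : nat)
    (cells : seq cell) (y : G) (l : seq G) (ls : seq (seq G)) :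
  explored x0 xs ((s, n.+1) :: cells) ((y :: l) :: ls) ->
  exists ms ls',
    [/\ ms \in splits ((s, n) :: cells) (k - count id s),
        admissible (adjmat xs) s ((s, n) :: cells) ms,
        adjmat (y :: xs) = next_matrix (adjmat xs) s
      & explored x0 (y :: xs) (next_cells s ((s, n) :: cells) ms) ls'].
Proof.
set rest := (s, n) :: cells; set L := l :: ls.
case=> uniq_all repr_all conn out.
have [] : [/\ size l = n, adjrow xs y = s, all (fun z => adjrow xs z == s) l
           & all2 (represents xs) cells ls].
  by case/andP: repr_all => /andP[/eqP[?] /andP[/eqP ? ?] ?]; split.
move=> size_l row_y rows_l rows_ls.
have reprL : all2 (represents xs) rest L.
  by rewrite /= /represents /= size_l eqxx rows_l rows_ls.
(* The neighbours of [y] that are neither visited nor in a cell; they become the last cell. *)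
pose F := [seq z <- enum G | sedge y z && (z \notin y :: xs ++ flatten L)].
have perm_yL : perm_eq (xs ++ flatten ((y :: l) :: ls)) (y :: xs ++ flatten L).
  by rewrite /= -cat1s perm_catCA.
have uniqA : uniq (y :: xs ++ flatten L ++ F).
  rewrite catA -cat_cons cat_uniq -(perm_uniq perm_yL) uniq_all.
  rewrite filter_uniq ?enum_uniq // andbT /=; apply/hasPn => z.
  by rewrite mem_filter => /andP[/andP[]].
have yA z : sedge y z -> z \in xs ++ flatten L ++ F.
  move=> yz; rewrite catA mem_cat mem_filter mem_enum yz andbT /= inE.
  have -> : z == y = false by apply: contraTF yz => /eqP ->; rewrite sedge_irr.
  by rewrite orbN.
have rowF z : z \in F -> adjrow xs z = nseq (size xs) false.
  rewrite mem_filter => /andP[/andP[_ z_new] _]; apply: out.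
  by rewrite (perm_mem perm_yL).
move: uniqA; rewrite cons_uniq => /andP[yA' uniqA].
have cnt P : #|[set z in neighbors y | P z]| = count (fun z => sedge y z && P z)
    (xs ++ flatten L ++ F) by apply: neighbors_count => // z /yA.
pose ms := [seq count (sedge y) l | l <- L].
have size_s : size s = size xs by rewrite -row_y size_map.
have cnt_s : count id s = count (sedge y) xs by rewrite -row_y count_map.
have degree : k = count id s + sumn ms + size F.
  have <- : #|[set z in neighbors y | true]| = k.
    by rewrite -(G_regular y); apply: eq_card => z; rewrite !inE andbT.
  rewrite (cnt xpredT); under eq_count do rewrite andbT.
  rewrite 2!count_cat cnt_s (count_flatten L) addnA; congr (_ + _).
  apply/eqP; rewrite -all_count; apply/allP => z.
  by rewrite mem_filter => /andP[/andP[->]].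
pose ls' := flatten [seq [:: [seq z <- l | sedge y z];
                             [seq z <- l | ~~ sedge y z]] | l <- L] ++ [:: F].
exists ms, [seq l <- ls' | size l != 0]; split.
- by apply: mem_splits; [exact: all2_count_le reprL | lia].
- apply/andP; split; first by lia.
  apply/allP => j; rewrite mem_iota size_s add0n => /= j_xs.
  set x := nth y xs j; have x_xs : x \in xs by apply: mem_nth.
  have yx : y != x by apply: contraNneq yA' => ->; rewrite mem_cat x_xs.
  have := G_codegrees yx.
  have -> : nth false s j = sedge y x by rewrite -row_y (nth_map y).
  suff -> : common_neighbors y x = codegree (adjmat xs) s rest ms j by [].
  rewrite /codegree (codegree_cells y y j_xs reprL).
  rewrite -row_y /adjrow /adjmat zip_map count_map.
  have := cnt (fun z => sedge x z); rewrite !count_cat => cntx.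
  have -> : common_neighbors y x = #|[set z in neighbors y | sedge x z]|.
    by apply: eq_card => z; rewrite !inE.
  rewrite cntx addnA -[RHS]addn0; congr (_ + _ + _).
    apply: eq_in_count => z z_xs /=.
    by rewrite (nth_map y) // (sedge_sym z).
  apply/eqP; rewrite -leqn0 leqNgt -has_count; apply/hasPn => z /rowF row_z.
  have := nth_map y false (sedge z) j_xs.
  rewrite -/(adjrow xs z) row_z nth_nseq j_xs.
  by rewrite -/x sedge_sym => <-; rewrite andbF.
- rewrite /adjmat /next_matrix /= sedge_irr row_y; congr cons.
  rewrite -row_y zip_map -map_comp; apply: eq_map => z /=.
  by rewrite sedge_sym.
- have perm_ls' : perm_eq ((y :: xs) ++ flatten [seq l <- ls' | size l != 0])
                    (y :: xs ++ flatten L ++ F).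
    rewrite flatten_filter_nonempty /ls' flatten_cat /= cats0 perm_cons.
    by rewrite perm_cat2l perm_cat2r (flatten_split y L).
  split.
  + by rewrite (perm_uniq perm_ls') /= yA' uniqA.
  + apply: all2_filter => [c l' /andP[/eqP <-] //|].
    apply: all2_cat; first exact: all2_represents_split.
    rewrite /= andbT /represents /=; apply/andP; split.
      by move: degree; rewrite /ms /= => degree; lia.
    apply/allP => z z_F; rewrite (rowF z z_F) size_s.
    by move: z_F; rewrite mem_filter sedge_sym => /andP[/andP[->]].
  + move=> z; rewrite (perm_mem perm_ls') catA -cat_cons mem_cat.
    rewrite -(perm_mem perm_yL).
    case/orP=> [/conn //|]; rewrite mem_filter => /andP[/andP[yz _] _].
    apply: connect_trans (connect1 yz).
    by apply: conn; rewrite (perm_mem perm_yL) inE eqxx.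
  + move=> z; rewrite (perm_mem perm_ls') => z_out.
    have yz : sedge y z = false.
      by apply: contraNF z_out => /yA; rewrite inE => ->; rewrite orbT.
    rewrite /= sedge_sym yz out // (perm_mem perm_yL).
    by move: z_out; rewrite catA -cat_cons mem_cat => /norP[].
Qed.

(** Induction along the branch selected by [G]; once no cell is left, the visited set is closed
    under adjacency. *)
Lemma search_sound (fuel : nat) (x0 : G) (xs : seq G) cells ls :
  explored x0 xs cells ls -> x0 \in xs -> search fuel (adjmat xs) cells ->
  exists ys : seq G,
    [/\ uniq ys, ys =i connect (@sedge G) x0 & leaf (adjmat ys)].
Proof.
elim: fuel xs cells ls => //= fuel IH xs [|[s [|n]] cells] ls expl x0_xs.
- move=> leaf_xs; case: expl; case: ls => // uniq_xs _ conn out.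
  rewrite cats0 in uniq_xs conn out; exists xs; split=> // y.
  apply/idP/idP => [/conn //|]; apply: closed_component => // {}y z y_xs yz.
  apply: contraTT yz => /out row_z.
  have := map_f (sedge z) y_xs; rewrite -/(adjrow xs z) row_z => /nseqP[+ _].
  by rewrite sedge_sym => ->.
- move=> srch; apply: (IH xs cells (behead ls)) x0_xs srch.
  case: ls expl => [|[|x l] ls] [uniq_all //= /andP[] // _ repr conn out].
- case: ls expl => [|[|y l] ls] expl; [by case: expl | by case: expl |].
  have [ms [ls' [ms_in adm mat_y expl']]] := search_step expl.
  move=> /allP /(_ ms); rewrite mem_filter adm ms_in => /(_ isT).
  by rewrite -mat_y; apply: IH expl' _; rewrite inE x0_xs orbT.
Qed.

Lemma component_search (fuel : nat) (x : G) :
  search fuel [:: [:: false]] [:: ([:: true], k)] ->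
  exists ys : seq G,
    [/\ uniq ys, ys =i connect (@sedge G) x & leaf (adjmat ys)].
Proof.
move=> srch.
(* At first [x] is visited and its [k] neighbours form the only cell. *)
have expl : explored x [:: x] [:: ([:: true], k)] [:: enum (neighbors x)].
  split=> [||y|y] /=; rewrite ?cats0.
  - by rewrite enum_uniq andbT mem_enum inE sedge_irr.
  - rewrite andbT /represents /= -cardE G_regular eqxx /=.
    by apply/allP => y; rewrite mem_enum inE sedge_sym => ->.
  - by rewrite inE mem_enum inE => /predU1P[->|/connect1 //]; apply: connect0.
  - by rewrite inE negb_or mem_enum inE sedge_sym => /andP[_ /negbTE ->].
apply: (search_sound (fuel := fuel) expl); first by rewrite inE.
by rewrite /adjmat /= sedge_irr.
Qed.

End ComponentSearch.

(** * Common neighbours in regular graphs and their complements *)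

Section Counting.

Variables (G : sgraph) (k : nat).
Hypothesis G_regular : regular G k.

Lemma common_neighborsC (x y : G) :
  common_neighbors x y = common_neighbors y x.
Proof. by rewrite /common_neighbors setIC. Qed.

Lemma common_neighbors_diag (x : G) : common_neighbors x x = k.
Proof. by rewrite /common_neighbors setIid. Qed.

(** Counts walks of length 2 from [x]: there are [k * k], and [k] of them return to [x]. *)
Lemma sum_common_neighbors (x : G) :
  \sum_(y | y != x) common_neighbors x y = k * k.-1.
Proof.
have: \sum_y common_neighbors x y = k * k.
  rewrite (eq_bigr (fun y => \sum_(z in neighbors x) (sedge z y : nat)));
    last first.
    move=> y _; rewrite /common_neighbors -sum1_card.
    rewrite (eq_bigl (fun z => (z \in neighbors x) && sedge z y)).
      by rewrite -big_mkcondr.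
    by move=> z; rewrite !inE (sedge_sym y).
  rewrite exchange_big /= -[RHS]mul1n.
  rewrite (eq_bigr (fun _ => k)); last first.
    move=> z _; rewrite -(G_regular z) -sum1_card [RHS]big_mkcond /=.
    by apply: eq_bigr => y _; rewrite inE; case: sedge.
  by rewrite sum_nat_const G_regular mul1n.
rewrite (bigD1 x) //= common_neighbors_diag; case: (k) => [|k']; lia.
Qed.

(* The triangle inequality for |N x \ N y| = k - |N x & N y|. *)
Lemma common_neighbors_triangle (x y z : G) :
  common_neighbors x y + common_neighbors y z <= k + common_neighbors x z.
Proof.
have subU : (neighbors x :&: neighbors y) :|: (neighbors y :&: neighbors z)
    \subset neighbors y by rewrite subUset subsetIr subsetIl.
have subI : (neighbors x :&: neighbors y) :&: (neighbors y :&: neighbors z)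
    \subset neighbors x :&: neighbors z.
  by apply/subsetP => w; rewrite !inE => /andP[/andP[-> _] /andP[_ ->]].
have := subset_leq_card subU; have := subset_leq_card subI.
have := cardsUI (neighbors x :&: neighbors y) (neighbors y :&: neighbors z).
rewrite G_regular /common_neighbors; lia.
Qed.

Lemma complement_neighbors (x : G) :
  neighbors (x : complement G) = ~: (x |: neighbors x).
Proof. by apply/setP => y; rewrite !inE negb_or eq_sym. Qed.

Lemma complement_regular (d : nat) :
  #|G| = k + d -> regular (complement G) d.-1.
Proof.
move=> cardG x; pose y : G := x; rewrite (complement_neighbors y).
suff : #|~: (y |: neighbors y)| = d.-1 by [].
have := cardsC (y |: neighbors y); rewrite cardsU1 inE sedge_irr G_regular.
rewrite cardG; lia.
Qed.

(** Inclusion-exclusion counts the vertices outside both neighbourhoods; [x] and [y] are among them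
    exactly if they are not adjacent, whence the 2. *)
Lemma complement_common_neighbors (d : nat) (x y : G) :
  #|G| = k + d -> x != y ->
  @common_neighbors (complement G) x y + ~~ sedge x y * 2 + k
  = d + common_neighbors x y.
Proof.
move=> cardG xy.
have := cardsC (neighbors x :|: neighbors y).
have := cardsUI (neighbors x) (neighbors y); rewrite !G_regular.
rewrite /common_neighbors !complement_neighbors -setCU [#|predT|]cardG.
set N := neighbors x :|: neighbors y => eqUI eqC.
have -> : x |: neighbors x :|: (y |: neighbors y) = N :|: [set x; y].
  by rewrite setUACA setUC.
have -> : ~: (N :|: [set x; y]) = ~: N :\: [set x; y] by rewrite setDE setCU.
suff : #|~: N :\: [set x; y]| + ~~ sedge x y * 2 + k
  = d + #|neighbors x :&: neighbors y| by [].
have := cardsID [set x; y] (~: N).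
have -> : #|~: N :&: [set x; y]| = ~~ sedge x y * 2.
  have inN z : (z \in ~: N) = ~~ (sedge x z || sedge y z) by rewrite !inE.
  case e_xy: (sedge x y); rewrite ?mul1n ?mul0n; last first.
    rewrite -[RHS](_ : #|[set x; y]| = 2); last by rewrite cards2 xy.
    apply: eq_card => z; rewrite in_setI inN !inE.
    case: eqP => [->|_]; first by rewrite sedge_irr sedge_sym e_xy.
    by case: eqP => [->|_]; rewrite ?andbF ?e_xy ?sedge_irr.
  apply/eqP; rewrite cards_eq0; apply/eqP/setP => z; rewrite in_setI inN !inE.
  case: eqP => [->|_]; first by rewrite sedge_irr sedge_sym e_xy.
  by case: eqP => [->|_]; rewrite ?andbF ?e_xy ?sedge_irr.
lia.
Qed.

End Counting.

(** * Partners and divisible designs *)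

Section Deza.

Variables (G : sgraph) (v k b a : nat).
Hypothesis G_deza : deza G v k b a.

Definition partners (c : nat) (x : G) : {set G} :=
  [set y | (y != x) && (common_neighbors x y == c)].

Lemma deza_regular : regular G k. Proof. by case: G_deza => -[]. Qed.
Lemma deza_card : #|G| = v. Proof. by case: G_deza => -[]. Qed.

(** Every other vertex contributes [a] to the count of walks of length 2, and a partner [b - a]
    more. *)
Lemma card_partners (x : G) :
  #|partners b x| * (b - a) + v.-1 * a = k * k.-1.
Proof.
case: G_deza => -[cardG reg] le_ab cn _ _.
rewrite -(sum_common_neighbors reg x).
have -> : v.-1 = \sum_(y | y != x) 1.
  by rewrite sum1_card -cardG -(cardC1 x).
rewrite -[#|_|]sum1_card !big_distrl /=.
rewrite (eq_bigl (fun y => (y != x) && (common_neighbors x y == b)));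
  last first.
  by move=> y; rewrite inE.
rewrite big_mkcondr /= -big_split /=; apply: eq_bigr => y yx.
have := cn x y; rewrite eq_sym => /(_ yx) []; case: eqP; lia.
Qed.

Lemma card_partners_const (x y : G) :
  a < b -> #|partners b x| = #|partners b y|.
Proof.
move=> lt_ab; have := card_partners x.
rewrite -(card_partners y) => /addIn /eqP.
by rewrite eqn_pmul2r ?subn_gt0 // => /eqP.
Qed.

Lemma partners_gt0 (x : G) : a < b -> 0 < #|partners b x|.
Proof.
move=> lt_ab; case: G_deza => _ _ _ _ [y [z [yz cn]]].
rewrite (card_partners_const x y lt_ab); apply/card_gt0P; exists z.
by rewrite inE eq_sym yz cn eqxx.
Qed.

Lemma partners_lt (x : G) : a < b -> #|partners b x| < v.-1.
Proof.
move=> lt_ab; case: G_deza => _ _ _ [y [z [yz cn]]] _.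
rewrite (card_partners_const x y lt_ab) -deza_card.
have -> : #|G|.-1 = #|[set~ y]| by rewrite cardsC1.
apply/proper_card/properP; split.
  by apply/subsetP => w; rewrite !inE => /andP[].
exists z; rewrite !inE eq_sym yz //= cn; apply/negbT; lia.
Qed.

Lemma deza_const_divisible : a = b -> is_divisible_design G.
Proof.
move=> eq_ab; case: G_deza => -[cardG reg] _ cn [x _] _.
(* A single class; [l2] is set to 0, as no two classes exist. *)
exists v, k, b, 0, 1, v; split=> //; exists [set [set: G]]; split.
- rewrite /partition /cover big_set1 eqxx trivIset1 inE /= eq_sym -card_gt0.
  by rewrite cardsT; apply/card_gt0P; exists x.
- by rewrite cards1.
- by move=> C; rewrite inE => /eqP ->; rewrite cardsT.
- by move=> C y z; rewrite inE => _ _ _ /cn []; rewrite ?eq_ab.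
- by move=> C D y z; rewrite !inE => /eqP -> /eqP ->; rewrite eqxx.
Qed.

(* Two partners of the same vertex have more than [a] common neighbours, so
   being equal or partners is an equivalence relation. *)
Lemma deza_gap_divisible : k + a < 2 * b -> is_divisible_design G.
Proof.
move=> gap; case: (G_deza) => -[cardG reg] le_ab cn _ [x [x' _]].
have lt_ab : a < b.
  have : b <= k by case: G_deza => _ _ _ _ [y [z [_ <-]]];
    rewrite -(reg y); apply: subset_leq_card; apply: subsetIl.
  lia.
pose R := [rel y z : G | (y == z) || (common_neighbors y z == b)].
have Rtrans y z w : R y z -> R z w -> R y w.
  rewrite /=; case: (eqVneq y z) => [-> //|yz] /= /eqP cyz.
  case: (eqVneq z w) => [<- _|zw] /=; first by rewrite cyz eqxx orbT.
  move=> /eqP czw; case: (eqVneq y w) => //= yw.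
  have := common_neighbors_triangle reg y z w; case: (cn y w yw) => ->; lia.
have Requiv : {in [set: G] & &, equivalence_rel R}.
  move=> y z w _ _ _; split; first by rewrite /= eqxx.
  move=> Ryz; apply/idP/idP; last exact: Rtrans.
  by apply: Rtrans; rewrite /= eq_sym common_neighborsC.
pose P := equivalence_partition R [set: G].
have partP : partition P [set: G] by apply: equivalence_partitionP.
have classE C y : C \in P -> y \in C -> C = [set z | R y z].
  move=> CP yC; apply/setP => z; rewrite inE.
  have tI : trivIset P by case/and3P: partP.
  have <- : pblock P y = C by apply: def_pblock.
  by rewrite pblock_equivalence_partition.
exists v, k, b, a, #|P|, #|partners b x|.+1; split=> //; exists P; split=> //.
- move=> C CP; have /card_gt0P [y yC] : 0 < #|C|.
    by rewrite card_gt0; case/and3P: partP => _ _; apply: contraNneq => <-.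
  rewrite (card_partners_const x y lt_ab) (classE C y CP yC) -add1n.
  rewrite -(_ : #|y |: partners b y| = (1 + _)%N); last first.
    by rewrite cardsU1 !inE eqxx.
  by apply: eq_card => z; rewrite !inE eq_sym; case: eqVneq.
- move=> C y z CP yC; rewrite (classE C y CP yC) inE /= => + yz.
  by rewrite (negbTE yz) => /eqP.
- move=> C D y z CP DP CD yC zD.
  have yz : ~~ R y z.
    apply: contra CD => Ryz; apply/eqP.
    have tI : trivIset P by case/and3P: partP.
    rewrite -(def_pblock tI CP yC) -(def_pblock tI DP zD).
    apply: same_pblock => //; rewrite (def_pblock tI DP zD) (classE D z DP zD).
    by rewrite inE /= eq_sym common_neighborsC.
  move: yz; rewrite /= negb_or => /andP[yz /eqP cyz].
  by case: (cn y z yz).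
Qed.

End Deza.

(** * From a finished search to embeddings *)

Lemma connected_search (k : nat) (adj nonadj : seq nat) leaf (fuel : nat)
    (G : sgraph) (x : G) :
  regular G k ->
  (forall x y : G, x != y ->
     common_neighbors x y \in if sedge x y then adj else nonadj) ->
  connected G ->
  search k adj nonadj leaf fuel [:: [:: false]] [:: ([:: true], k)] ->
  exists ys : seq G, [/\ uniq ys, ys =i G & leaf (adjmat ys)].
Proof.
move=> reg cn conn srch.
have [ys [ys_uniq ys_conn leaf_ys]] := component_search reg cn x srch.
by exists ys; split=> // y; rewrite ys_conn [RHS]inE; apply: conn.
Qed.

Lemma size_adjmat (G : sgraph) (ys : seq G) : size (adjmat ys) = size ys.
Proof. exact: size_map. Qed.

(** Equal positions correspond. [ys] may be just one component of [G], as in a disjoint union of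
    cubes. *)
Lemma adjmat_embedding (G H : sgraph) (ys : seq G) (zs : seq H) (y0 : G) :
  uniq ys -> y0 \in ys -> uniq zs -> size zs = #|H| -> adjmat ys = adjmat zs ->
  exists f : H -> G,
    [/\ injective f, forall x y, sedge (f x) (f y) = sedge x y
      & forall y, y \in ys <-> exists z, f z = y].
Proof.
move=> ys_uniq y0_ys zs_uniq size_zs mat.
have size_ys : size ys = size zs by rewrite -size_adjmat mat size_adjmat.
have zs_all z : z \in zs.
  have sub_enum : {subset zs <= enum H} by move=> w; rewrite mem_enum.
  have [|_ ->] := uniq_min_size zs_uniq sub_enum; last by rewrite mem_enum.
  by rewrite size_zs cardE.
have ltz z : index z zs < size zs by rewrite index_mem.
pose f z := nth y0 ys (index z zs).
exists f; split.
- move=> z w /eqP; rewrite nth_uniq ?size_ys // => /eqP eq_zw.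
  by rewrite -(nth_index z (zs_all z)) eq_zw nth_index.
- move=> z w.
  have := congr1
    (fun M => nth false (nth [::] M (index z zs)) (index w zs)) mat.
  rewrite /= /adjmat /adjrow !(nth_map y0) ?size_map ?size_ys //.
  by rewrite !(nth_map z) ?size_map // !nth_index.
- move=> y; split=> [y_ys|[z <-]]; last by rewrite mem_nth ?size_ys.
  have lt_y : index y ys < size zs by rewrite -size_ys index_mem.
  have /hasP[z0 _ _] : has predT zs by rewrite has_predT; case: (size zs) lt_y.
  by exists (nth z0 zs (index y ys)); rewrite /f index_uniq // nth_index.
Qed.

Lemma isomorphic_adjmat (G H : sgraph) (ys : seq G) (zs : seq H) (y0 : G) :
  uniq ys -> ys =i G -> uniq zs -> size zs = #|H| -> adjmat ys = adjmat zs ->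
  isomorphic G H.
Proof.
move=> ys_uniq ys_all zs_uniq size_zs mat.
have [|f [f_inj f_edge f_surj]] :=
    adjmat_embedding (y0 := y0) ys_uniq _ zs_uniq size_zs mat.
  by rewrite ys_all.
have f_bij : bijective f.
  apply: inj_card_bij => //.
  rewrite -size_zs -(size_adjmat zs) -mat size_adjmat.
  by rewrite -(card_uniqP ys_uniq); apply/eq_leq/esym/eq_card.
case: f_bij => g fK gK; exists g; first by exists f.
by move=> x y; rewrite -[in RHS](gK x) -[in RHS](gK y) f_edge.
Qed.

(** * Models of the cubes and the Fano graph for computation *)

(** Binary digits encode cube vertices as numbers, so that adjacency is computed without finite
    functions. *)
Definition bit (n i : nat) : bool := odd (n %/ 2 ^ i).

Definition bits_edge (d m n : nat) : bool :=
  count (fun i => bit m i != bit n i) (iota 0 d) == 1.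

Definition vertex (d n : nat) : hypercube d := [ffun i : 'I_d => bit n i].

Lemma vertex_edge (d m n : nat) :
  sedge (vertex d m) (vertex d n) = bits_edge d m n.
Proof.
rewrite /= /cube_edge /bits_edge; congr (_ == _).
rewrite -sum1_card -sum1_count -val_enum_ord big_map big_enum_cond /=.
by apply: eq_bigl => i; rewrite !inE !ffunE.
Qed.

Lemma card_hypercube (d : nat) : #|hypercube d| = 2 ^ d.
Proof. by rewrite card_ffun card_bool card_ord. Qed.

Lemma uniq_vertices (d : nat) (ns : seq nat) :
  uniq [seq [seq bit n i | i <- iota 0 d] | n <- ns] ->
  uniq [seq vertex d n | n <- ns].
Proof.
move=> uniq_bits.
apply: (@map_uniq _ _ (fun x : hypercube d => [seq x i | i <- enum 'I_d])).
rewrite -map_comp.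
rewrite (eq_map (g := fun n => [seq bit n i | i <- iota 0 d])) // => n /=.
by rewrite -val_enum_ord -map_comp; apply: eq_map => i; rewrite /= ffunE.
Qed.

Definition bits_matrix (d : nat) (ns : seq nat) : seq (seq bool) :=
  [seq [seq bits_edge d m n | n <- ns] | m <- ns].

Lemma adjmat_hypercube (d : nat) (ns : seq nat) :
  adjmat [seq vertex d n | n <- ns] = bits_matrix d ns.
Proof.
rewrite /adjmat /adjrow -map_comp; apply: eq_map => m /=; rewrite -map_comp.
by apply: eq_map => n; apply: vertex_edge.
Qed.

(* These orders, latest first, are the ones in which [search] visits the
   vertices. *)
Definition cube3_order : seq nat := [:: 0; 1; 2; 4; 3; 5; 6; 7].
Definition cube4_order : seq nat :=
  [:: 0; 1; 2; 4; 8; 3; 5; 9; 6; 10; 12; 7; 11; 13; 14; 15].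

Definition fano_vertex (n : nat) : fano_nonincidence :=
  if n < 7 then inl (inZp n) else inr (inZp (n - 7)).

(** Lines as lists in place of sets, so that the adjacency matrix evaluates. *)
Definition fano_edge : rel fano_nonincidence :=
  fun x y => match x, y with
  | inl p, inr j | inr j, inl p => p \notin [:: j; j + 1; j + 3]%R
  | _, _ => false
  end.

Lemma fano_edgeE : @sedge fano_nonincidence =2 fano_edge.
Proof. by move=> [p|j] [p'|j'] //=; rewrite !inE orbA. Qed.

(** Arranged like the matrix in which the search ends, so that both matrices agree literally. *)
Definition fano_order : seq fano_nonincidence :=
  map fano_vertex [:: 0; 1; 3; 11; 8; 10; 9; 12; 13; 6; 2; 5; 4; 7].

Definition fano_matrix : seq (seq bool) :=
  [seq [seq fano_edge x y | y <- fano_order] | x <- fano_order].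

Lemma adjmat_fano : adjmat fano_order = fano_matrix.
Proof. by apply: eq_map => x; apply: eq_map => y; apply: fano_edgeE. Qed.

Lemma uniq_fano_order : uniq fano_order.
Proof. by vm_compute. Qed.

Lemma card_fano_nonincidence : #|fano_nonincidence| = 14.
Proof. by rewrite card_sum card_ord. Qed.

(** * Graphs recognised by search *)

(** Graphs on 8 vertices are left unidentified: they have [d = 4] and are treated through their
    complements. *)
Lemma rectagraph4 (G : sgraph) (x : G) :
  regular G 4 -> connected G ->
  (forall x y : G, x != y -> common_neighbors x y \in [:: 0; 2]) ->
  [\/ #|G| = 8, isomorphic G fano_nonincidence | isomorphic G (hypercube 4)].
Proof.
move=> reg conn cn.
pose leaf M :=
  [|| size M == 8, M == fano_matrix | M == bits_matrix 4 cube4_order].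
(* Each new vertex costs one unit of fuel, so 20 leaves room for the 16 vertices of the 4-cube. *)
have srch : search 4 [:: 0; 2] [:: 0; 2] leaf 20
              [:: [:: false]] [:: ([:: true], 4)] by vm_compute.
have [| ys [ys_uniq ys_all leaf_ys]] := connected_search x reg _ conn srch.
  by move=> y z /cn; rewrite if_same.
case/or3P: leaf_ys => [|/eqP|/eqP] h.
- apply: Or31; move: h; rewrite size_adjmat -(card_uniqP ys_uniq) => /eqP <-.
  exact/esym/eq_card.
- apply: Or32; apply: (isomorphic_adjmat x ys_uniq ys_all uniq_fano_order).
    by rewrite card_fano_nonincidence.
  by rewrite h adjmat_fano.
- have uniq4 : uniq [seq vertex 4 n | n <- cube4_order].
    by apply: uniq_vertices; vm_compute.
  apply: Or33; apply: (isomorphic_adjmat x ys_uniq ys_all uniq4).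
  + by rewrite card_hypercube.
  + by rewrite h adjmat_hypercube.
Qed.

(** The search shows that each component is a 3-cube; roots of components index the copies. *)
Lemma disjoint_cubes (G : sgraph) :
  regular G 3 ->
  (forall x y : G, x != y ->
    common_neighbors x y \in if sedge x y then [:: 0] else [:: 0; 2]) ->
  exists s, isomorphic G (copies s (hypercube 3)).
Proof.
move=> reg cn.
have cubes (x : G) : exists f : {ffun hypercube 3 -> G},
    [/\ injective f, forall p q, sedge (f p) (f q) = sedge p q
      & forall y, (exists p, f p = y) <-> connect (@sedge G) x y].
  pose leaf M := M == bits_matrix 3 cube3_order.
  have srch : search 3 [:: 0] [:: 0; 2] leaf 20
                [:: [:: false]] [:: ([:: true], 3)] by vm_compute.
  have [ys [ys_uniq ys_conn /eqP leaf_ys]] := component_search reg cn x srch.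
  have [||||f [f_inj f_edge f_surj]] := adjmat_embedding (y0 := x)
      (zs := [seq vertex 3 n | n <- cube3_order]) ys_uniq.
  - by rewrite ys_conn; apply: connect0.
  - by apply: uniq_vertices; vm_compute.
  - by rewrite card_hypercube.
  - by rewrite leaf_ys adjmat_hypercube.
  exists (finfun f); split.
  - by move=> p q; rewrite !ffunE => /f_inj.
  - by move=> p q; rewrite !ffunE.
  - move=> y; rewrite -[connect _ x y]ys_conn; split=> [[p <-]|/f_surj[p <-]].
      by rewrite ffunE f_surj; exists p.
    by exists p; rewrite ffunE.
have {cubes} [f f_cube] := fin_all_exists cubes.
pose R := [set x : G | fingraph.root (@sedge G) x == x].
have connC := @connect_symmetric G.
exists #|R|; pose h (u : copies #|R| (hypercube 3)) : G := f (enum_val u.1) u.2.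
(* The root of [h u] recovers the copy of [u]; so distinct copies are disjoint and not joined by
   edges. *)
have rootE u : fingraph.root (@sedge G) (h u) = enum_val u.1.
  have [_ _ f_conn] := f_cube (enum_val u.1).
  have /f_conn : exists p, f (enum_val u.1) p = h u by exists u.2.
  move/(fingraph.rootP connC) => <-.
  by have := enum_valP u.1; rewrite inE => /eqP.
have h_inj : injective h.
  move=> [i p] [j q] eq_h; have := rootE (i, p).
  rewrite eq_h rootE => /enum_val_inj /= eq_ij.
  move: eq_h; rewrite {}eq_ij /h /=; have [f_inj _ _] := f_cube (enum_val i).
  by move=> /f_inj ->.
have h_surj y : exists u, h u = y.
  have rR : fingraph.root (@sedge G) y \in R by rewrite inE fingraph.root_root.
  have [_ _ f_conn] := f_cube (fingraph.root (@sedge G) y).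
  have [p <-] : exists p, f (fingraph.root (@sedge G) y) p = y.
    by apply/f_conn; rewrite connC connect_root.
  exists (enum_rank_in rR (fingraph.root (@sedge G) y), p).
  by rewrite /h /= enum_rankK_in.
have h_edge u w : sedge (h u) (h w) = sedge u w.
  case: u w => [i p] [j q]; rewrite /= /copies_edge /=.
  case: (eqVneq i j) => [<-|ij] /=.
    by have [_ -> _] := f_cube (enum_val i).
  apply: contraNF ij => /connect1 /(fingraph.rootP connC).
  by rewrite !rootE => /enum_val_inj /= ->.
have [g hK gK] : bijective h.
  apply: inj_card_bij => //; rewrite -(card_codom h_inj); apply/subset_leq_card.
  by apply/subsetP => y _; have [u <-] := h_surj y; apply: codom_f.
by exists g => [|x y]; [exists h | rewrite -h_edge !gK].
Qed.

Lemma isomorphic_complement (G H : sgraph) :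
  isomorphic (complement G) H -> isomorphic G (complement H).
Proof.
case=> f f_bij f_edge; exists f => // x y.
rewrite /= /compl_edge f_edge (bij_eq f_bij) /= /compl_edge.
by case: (eqVneq x y) => [->|_]; rewrite ?sedge_irr ?negbK.
Qed.

Lemma isomorphic_card (G H : sgraph) : isomorphic G H -> #|G| = #|H|.
Proof. by case=> f f_bij _; apply: bij_eq_card f_bij. Qed.

(** * Distances and diameter *)

Section Distances.

Variable G : sgraph.
Implicit Types x y z : G.

Lemma gdist_le (n : nat) x y :
  n < #|G| -> walk_of_length n x y -> gdist x y <= n.
Proof.
move=> n_lt walk; rewrite leqNgt; apply/negP => /(before_find 0).
by rewrite nth_iota // add0n walk.
Qed.

Lemma gdist_walk x y : gdist x y < #|G| -> walk_of_length (gdist x y) x y.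
Proof.
rewrite -[#|G|](size_iota 0) -has_find => has_walk.
have := nth_find 0 has_walk; rewrite nth_iota ?add0n //.
by move: has_walk; rewrite has_find size_iota.
Qed.

(** [2 < #|G|] keeps the value that stands for infinity above 2. *)
Lemma gdist_le2P x y : 2 < #|G| ->
  reflect [\/ x = y, sedge x y | exists z, sedge x z /\ sedge z y]
          (gdist x y <= 2).
Proof.
move=> cardG; apply: (iffP idP) => [dist|].
  have := gdist_walk (leq_ltn_trans dist cardG).
  case: (gdist x y) dist => [|[|[|]]] // _ /existsP[p] /andP[].
  - by rewrite (tuple0 p) => _ /eqP; apply: Or31.
  - case/tupleP: p => z p; rewrite (tuple0 p) /= andbT => xz /eqP <-.
    exact: Or32.
  - case/tupleP: p => z p; case/tupleP: p => w p; rewrite (tuple0 p) /= andbT.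
    by move=> /andP[xz zw] /eqP <-; apply: Or33; exists z.
case=> [<-|xy|[z [xz zy]]].
- apply: (@leq_trans 0) => //; apply: gdist_le; first by lia.
  by apply/existsP; exists [tuple] => /=.
- apply: (@leq_trans 1) => //; apply: gdist_le; first by lia.
  by apply/existsP; exists [tuple y] => /=; rewrite xy eqxx.
- apply: gdist_le => //.
  by apply/existsP; exists [tuple z; y] => /=; rewrite xz zy eqxx.
Qed.

Lemma common_neighborsP x y :
  reflect (exists z, sedge x z /\ sedge z y) (0 < common_neighbors x y).
Proof.
apply: (iffP card_gt0P) => [[z]|[z [xz zy]]].
  by rewrite !inE (sedge_sym y) => /andP[xz zy]; exists z.
by exists z; rewrite !inE xz (sedge_sym y).
Qed.

Lemma gdist_le_diameter x y : gdist x y <= diameter G.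
Proof.
apply: leq_trans (leq_bigmax (F := fun x => \max_y gdist x y) x).
exact: (leq_bigmax (F := gdist x)).
Qed.

Lemma exists_nonneighbor (k : nat) x :
  regular G k -> k.+1 < #|G| -> exists2 y, x != y & ~~ sedge x y.
Proof.
move=> reg cardG; have /card_gt0P [y] : 0 < #|~: (x |: neighbors x)|.
  have := cardsC (x |: neighbors x); rewrite cardsU1 inE sedge_irr reg; lia.
by rewrite !inE negb_or eq_sym => /andP[]; exists y.
Qed.

(** Common neighbours bound distances by 2, and a non-adjacent pair, present by the bound on [#|G|],
    attains it. *)
Lemma diameter2 (k : nat) :
  regular G k -> 0 < k -> k.+1 < #|G| ->
  (forall x y, x != y -> 0 < common_neighbors x y) -> diameter G = 2.
Proof.
move=> reg k_gt0 cardG cn; have cardG2 : 2 < #|G| by lia.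
have /card_gt0P [x _] : 0 < #|G| by lia.
have [y xy nxy] := exists_nonneighbor x reg cardG.
apply/eqP; rewrite eqn_leq; apply/andP; split.
  apply/bigmax_leqP => z _; apply/bigmax_leqP => w _; apply/gdist_le2P => //.
  case: (eqVneq z w) => [->|zw]; [exact: Or31 | apply: Or33].
  exact/common_neighborsP/cn.
apply: leq_trans (gdist_le_diameter x y); rewrite ltnNge; apply/negP => dist.
have := gdist_walk (leq_ltn_trans dist (ltnW cardG2)).
case: (gdist x y) dist => [|[|//]] _ /existsP[p /andP[]].
  by rewrite (tuple0 p) /= => _ /eqP e; rewrite e eqxx in xy.
case/tupleP: p => z p; rewrite (tuple0 p) /= andbT => xz /eqP e.
by rewrite -e xz in nxy.
Qed.

End Distances.

(** * Consequences of a search, and bounds on the order *)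

(** With the constantly false leaf, success means that every branch dies, so no such graph
    exists. *)
Lemma search_no_leaf (k : nat) (adj nonadj : seq nat) (fuel : nat)
    (G : sgraph) (x : G) :
  regular G k ->
  (forall x y : G, x != y ->
     common_neighbors x y \in if sedge x y then adj else nonadj) ->
  search k adj nonadj (fun=> false) fuel [:: [:: false]] [:: ([:: true], k)] ->
  False.
Proof. by move=> reg cn /(component_search reg cn x) [? []]. Qed.

Lemma search_leaf_size (k : nat) (adj nonadj : seq nat) (n fuel : nat)
    (G : sgraph) (x : G) :
  regular G k ->
  (forall x y : G, x != y ->
     common_neighbors x y \in if sedge x y then adj else nonadj) ->
  search k adj nonadj (fun M => n <= size M) fuel
         [:: [:: false]] [:: ([:: true], k)] ->
  n <= #|G|.
Proof.
move=> reg cn /(component_search reg cn x) [ys [ys_uniq _]].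
rewrite size_adjmat => le_n; apply: leq_trans le_n _.
by rewrite -(card_uniqP ys_uniq) max_card.
Qed.

(* With [d = v - k], the closed neighbourhoods of the complement have [d]
   elements and those of two of its adjacent vertices share at least two. *)
Lemma deza_card_ge (G : sgraph) (v k b a : nat) :
  deza G v k b a -> k = b + 2 -> exists e, v = k + (e + 4).
Proof.
move=> [[cardG reg] le_ab cn [x [y [xy _]]] _] k_b2.
have le_kv : k <= #|G| by rewrite -(reg x) max_card.
pose d := #|G| - k; have cardG' : #|G| = k + d by lia.
have cn_le (z w : G) : z != w -> common_neighbors z w <= b.
  by move=> zw; case: (cn z w zw) => ->; lia.
(* The formula for the complement gives [d >= 2] from any pair; hence [x] has a non-neighbour, and
   that pair gives [d >= 4]. *)
have d_ge2 : 1 < d.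
  have := complement_common_neighbors reg cardG' xy.
  by have := cn_le x y xy; lia.
have /card_gt0P [z] : 0 < #|neighbors (x : complement G)|.
  by rewrite (complement_regular reg cardG'); lia.
rewrite inE => /andP[xz nxz].
have := complement_common_neighbors reg cardG' xz; have := cn_le x z xz.
by rewrite nxz; exists (d - 4); lia.
Qed.

(** Adjacency in the complement is non-adjacency in [G], so the summand 2 of the complement formula
    falls to [adj]. *)
Lemma complement_codegrees (G : sgraph) (k a b d : nat) (adj nonadj : seq nat) :
  regular G k -> #|G| = k + d ->
  (forall x y : G, x != y ->
    common_neighbors x y = a \/ common_neighbors x y = b) ->
  (forall c t, c \in [:: a; b] -> t + 2 + k = d + c -> t \in adj) ->
  (forall c t, c \in [:: a; b] -> t + k = d + c -> t \in nonadj) ->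
  forall x y : complement G, x != y ->
    common_neighbors x y \in if sedge x y then adj else nonadj.
Proof.
move=> reg cardG cn adjP nonadjP x y xy.
have := complement_common_neighbors reg cardG (xy : (x : G) != y).
have cn_ab : @common_neighbors G x y \in [:: a; b].
  by rewrite !inE; case: (cn x y xy) => ->; rewrite eqxx ?orbT.
rewrite /= /compl_edge xy /=; case: (sedge (x : G) y) => /= h.
  by apply: nonadjP cn_ab _; rewrite addn0 in h.
exact: adjP cn_ab h.
Qed.

Lemma deza_codegrees (G : sgraph) (v k b a : nat) (x y : G) :
  deza G v k b a -> x != y ->
  common_neighbors x y \in if sedge x y then [:: a; b] else [:: a; b].
Proof.
case=> _ _ cn _ _ /cn; rewrite if_same !inE.
by case=> ->; rewrite eqxx ?orbT.
Qed.

Lemma deza_inhabited (G : sgraph) (v k b a : nat) :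
  deza G v k b a -> exists x : G, True.
Proof. by case=> _ _ _ [x _] _; exists x. Qed.

(** * The case [c = 4] *)

(** With [e = d - 4] the walk count reads [2 * beta + e * a = 12]. For [e = 0] the complement is
    cubic, for [a = 0] the graph has degree 4; otherwise the count and searches exclude every
    case. *)
Lemma deza_gap4 (G : sgraph) (v a : nat) :
  connected G -> deza G v (a + 4) (a + 2) a ->
  [\/ exists s : nat,
        [/\ 0 < s,
            isomorphic G (complement (copies s (hypercube 3)))
          & deza G (8 * s) (8 * (s - 1) + 4) (8 * (s - 1) + 2)
              (8 * (s - 1))],
      deza G 14 4 2 0 /\ isomorphic G fano_nonincidence
    | isomorphic G (hypercube 4) /\ deza G 16 4 2 0].
Proof.
move=> G_connected G_deza; have [x _] := deza_inhabited G_deza.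
have reg := deza_regular G_deza; have cardG := deza_card G_deza.
have [e v_e] : exists e, v = a + 4 + (e + 4).
  by apply: deza_card_ge G_deza _; lia.
have cardGe : #|G| = a + 4 + (e + 4) by rewrite cardG.
have cn y z := deza_codegrees (x := y) (y := z) G_deza.
have [_ _ cn_ab _ _] := G_deza.
have coreg := complement_regular reg cardGe.
have cocn := complement_codegrees reg cardGe cn_ab.
have gt0 : 0 < #|partners (a + 2) x| by apply: (partners_gt0 G_deza x); lia.
have count : 2 * #|partners (a + 2) x| + e * a = 12.
  have := card_partners G_deza x; rewrite v_e; nia.
have [e0|e_gt0] := posnP e.
  apply: Or31; rewrite {}e0 in cardGe coreg cocn.
  have [|s iso] := disjoint_cubes (coreg : regular (complement G) 3).
    by apply: cocn => c t; rewrite !inE => /pred2P[] ->; lia.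
  have card_s : #|G| = s * 8.
    by rewrite (isomorphic_card iso) card_prod card_ord card_hypercube.
  have s_gt0 : 0 < s by case: (s) card_s cardGe => //; lia.
  exists s; split=> //; first exact: isomorphic_complement.
  have [-> -> ->] : [/\ 8 * s = v, 8 * (s - 1) + 4 = a + 4 & 8 * (s - 1) = a].
    by split; lia.
  exact: G_deza.
have [a0|a_gt0] := posnP a.
  have [||card8|iso|iso] := rectagraph4 x _ G_connected.
  - by move: reg; rewrite a0.
  - by move=> y z /cn; rewrite if_same a0.
  - lia.
  - apply: Or32; split=> //; move: G_deza.
    by rewrite -cardG (isomorphic_card iso) card_fano_nonincidence a0.
  - apply: Or33; split=> //; move: G_deza.
    by rewrite -cardG (isomorphic_card iso) card_hypercube a0.
exfalso; have [e1|e2|e_ge3] : [\/ e = 1, e = 2 | 3 <= e].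
  case: (e) e_gt0 => [|[|[|]]] // *;
    by [apply: Or31 | apply: Or32 | apply: Or33].
- rewrite {}e1 in cardGe coreg cocn.
  apply: (@search_no_leaf 4 [:: 1] [:: 1; 3] 20 (complement G) x coreg).
    by apply: cocn => c t; rewrite !inE => /pred2P[] ->; lia.
  by vm_compute.
- rewrite {}e2 in cardGe coreg cocn count.
  (* The count gives [a <= 5], so [G] has at most 15 vertices. *)
  suff : 16 <= #|G| by rewrite cardGe; lia.
  apply: (@search_leaf_size 5 [:: 0; 2] [:: 2; 4] 16 20 (complement G) x coreg).
    by apply: cocn => c t; rewrite !inE => /pred2P[] ->; lia.
  by vm_compute.
have a_le3 : a <= 3 by nia.
(* For [a = 3] the count forces [e = 4] by parity, which leaves no partners. *)
have a_neq3 : a != 3 by apply/eqP => a3; rewrite a3 in count gt0; lia.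
have [a1|a2] : a = 1 \/ a = 2 by lia.
- rewrite {}a1 in reg cn.
  by apply: (@search_no_leaf 5 _ _ 20 G x reg cn); vm_compute.
- rewrite {}a2 in reg cn count gt0 cardGe.
  (* The count gives [e <= 5], so again there are at most 15 vertices. *)
  have : 16 <= #|G|.
    by apply: (@search_leaf_size 6 _ _ 16 20 _ x reg cn); vm_compute.
  lia.
Qed.

(** * The case [c = 3] *)

Lemma deza_k3 (G : sgraph) (v : nat) :
  deza G v 3 1 0 -> connected G ->
  2 < diameter G \/ strongly_regular G 10 3 0 1.
Proof.
move=> G_deza conn.
have [x0 _] := deza_inhabited G_deza.
have reg := deza_regular G_deza; have cardG := deza_card G_deza.
have [e v_e] : exists e, v = 3 + (e + 4) by apply: deza_card_ge G_deza _.
have cardGe : #|G| = 3 + (e + 4) by rewrite cardG.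
have [_ _ cn _ _] := G_deza.
have count (x : G) : #|partners 1 x| = 6 by have := card_partners G_deza x; lia.
have v_ge8 : 8 <= v.
  by have := partners_lt G_deza x0 isT; rewrite count; lia.
(* For [v = 8] the complement has degree 4, and the search finds at least 9 vertices in its
   components. *)
have v_neq8 : v != 8.
  apply/eqP => v8; have e1 : e = 1 by lia.
  rewrite {}e1 in cardGe.
  suff : 9 <= #|G| by rewrite cardGe.
  apply: (@search_leaf_size 4 [:: 0; 1] [:: 2; 3] 9 20 (complement G) x0
            (complement_regular reg cardGe)).
    apply: (complement_codegrees reg cardGe cn) => c t;
      by rewrite !inE => /pred2P[] ->; lia.
  by vm_compute.
case: (ltnP 2 (diameter G)) => diam; [by left | right].
have near (x y : G) : x != y -> ~~ sedge x y -> common_neighbors x y = 1.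
  move=> xy nxy.
  have : gdist x y <= 2 := leq_trans (gdist_le_diameter x y) diam.
  have card2 : 2 < #|G| by lia.
  case/(gdist_le2P _ _ card2) => [xyE|exy|/common_neighborsP].
  - by rewrite xyE eqxx in xy.
  - by rewrite exy in nxy.
  - by case: (cn x y xy) => ->.
(* The neighbours of [x] that lie in a triangle with [x]. *)
pose T (x : G) := [set y in neighbors x | common_neighbors x y == 1].
(* At diameter at most 2 the 6 partners of [x] are the members of [T x] and the [v - 4]
   non-neighbours of [x]. *)
have cardT x : #|T x| + v = 10.
  have -> : v = #|~: (x |: neighbors x)| + 4.
    have := cardsC (x |: neighbors x); rewrite cardsU1 inE sedge_irr reg; lia.
  suff : #|partners 1 x| = #|T x| + #|~: (x |: neighbors x)|.
    by rewrite count; lia.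
  rewrite -cardsUI -[LHS]addn0; congr (_ + _); last first.
    apply/esym/eqP; rewrite cards_eq0; apply/eqP/setP => y; rewrite !inE.
    by case: (sedge x y); rewrite ?orbT ?andbF.
  apply: eq_card => y; rewrite !inE negb_or.
  case: (eqVneq y x) => [->|yx] /=; first by rewrite sedge_irr.
  case exy: (sedge x y) => /=; first by rewrite orbF.
  by rewrite near ?exy // eq_sym.
(* A triangle at [x] puts two vertices into [T x], but [v >= 9] allows only one. *)
have T0 x : T x = set0.
  apply/setP => y; rewrite in_set0; apply/negP => yT.
  have cardT1 : #|T x| = 1 by have := cardT x; rewrite (cardsD1 y) yT; lia.
  move: (yT); rewrite !inE => /andP[xy /eqP cxy].
  have [z [xz zy]] : exists z, sedge x z /\ sedge z y.
    by apply/common_neighborsP; rewrite cxy.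
  have zT : z \in T x.
    rewrite !inE xz /=; have xz' : x != z.
      by apply: contraTneq xz => <-; rewrite sedge_irr.
    have : 0 < common_neighbors x z.
      by apply/common_neighborsP; exists y; rewrite xy sedge_sym.
    by case: (cn x z xz') => ->.
  have /cards1P [w Tw] : #|T x| == 1 by rewrite cardT1.
  move: yT zT; rewrite Tw !inE => /eqP yw /eqP zw.
  by rewrite yw zw sedge_irr in zy.
split; [| exact: reg | | exact: near].
  by rewrite cardG; have := cardT x0; rewrite T0 cards0; lia.
move=> x y xy; have xy' : x != y.
  by apply: contraTneq xy => <-; rewrite sedge_irr.
case: (cn x y xy') => // cxy.
by have : y \in T x; [rewrite !inE xy cxy eqxx | rewrite T0 inE].
Qed.

(** The walk count with [b - a = 1] and [e = d - 4]. *)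
Lemma deza_gap3_excess (G : sgraph) (v a e : nat) (x : G) :
  deza G v (a + 3) (a + 1) a -> v = a + 3 + (e + 4) ->
  #|partners (a + 1) x| + e.+1 * a = 6.
Proof.
by move=> G_deza v_e; have := card_partners G_deza x; rewrite v_e; nia.
Qed.

(** The search leaves [v = 8] and [v = 9]; the diameter is 2 as [a > 0]. What remains is that a
    strongly regular [G] has parameters (9,4,1,2). *)
Lemma deza_k4 (G : sgraph) (v : nat) :
  deza G v 4 2 1 -> connected G ->
  (strictly_deza G 8 4 2 1 \/ strictly_deza G 9 4 2 1)
  \/ strongly_regular G 9 4 1 2.
Proof.
move=> G_deza conn.
have [x _] := deza_inhabited G_deza.
have reg := deza_regular G_deza; have cardG := deza_card G_deza.
have [_ _ cn _ _] := G_deza.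
have [e v_e] : exists e, v = 4 + (e + 4) by apply: deza_card_ge G_deza _.
have count : #|partners 2 x| + e.+1 * 1 = 6.
  exact: deza_gap3_excess x (G_deza : deza G v (1 + 3) (1 + 1) 1) v_e.
have v89 : v = 8 \/ v = 9.
  pose leaf (M : seq (seq bool)) := (size M == 8) || (size M == 9).
  have srch : search 4 [:: 1; 2] [:: 1; 2] leaf 20
                [:: [:: false]] [:: ([:: true], 4)] by vm_compute.
  have [ys [ys_uniq ys_all]] :=
    connected_search x reg (fun y z => deza_codegrees G_deza) conn srch.
  rewrite /leaf size_adjmat -(card_uniqP ys_uniq) (eq_card ys_all) cardG.
  by case/orP=> /eqP; [left | right].
have cardG5 : 5 < #|G| by rewrite cardG; case: v89 => ->.
have diam : diameter G = 2.
  by apply: diameter2 reg _ _ _ => // y z /cn[] ->.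
have [/andP[/eqP v9 /forallP srg]|nsrg] := boolP ((v == 9) &&
    [forall y : G, forall z : G,
      (y != z) ==> (common_neighbors y z == (if sedge y z then 1 else 2))]).
  right; split; [by rewrite cardG | exact: reg | |] => y z.
    move=> yz; have yz' : y != z.
      by apply: contraTneq yz => <-; rewrite sedge_irr.
    by have /forallP/(_ z) := srg y; rewrite yz' yz => /eqP.
  move=> yz nyz.
  by have /forallP/(_ z) := srg y; rewrite yz (negbTE nyz) => /eqP.
suff nSR : ~ is_strongly_regular G.
  by left; case: v89 => v_eq; rewrite v_eq in G_deza; [left | right]; split.
case=> [v' [k' [l [mu [_ _ cn_adj cn_nonadj]]]]].
have partnersE (y : G) : (y \in partners 2 x)
    = (y != x) && ((if sedge x y then l else mu) == 2).
  rewrite inE; case: (eqVneq y x) => //= yx.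
  case exy: (sedge x y); first by rewrite (cn_adj _ _ exy).
  by rewrite (cn_nonadj x y) ?exy // eq_sym.
have card_nonadj : #|~: (x |: neighbors x)| = v - 5.
  have := cardsC (x |: neighbors x); rewrite cardsU1 inE sedge_irr reg; lia.
have [z xz] : exists z, sedge x z.
  have /card_gt0P[z] : 0 < #|neighbors x| by rewrite reg.
  by rewrite inE; exists z.
have [w xw nxw] := exists_nonneighbor x reg cardG5.
have l12 : l = 1 \/ l = 2.
  rewrite -(cn_adj _ _ xz); apply: cn.
  by apply: contraTneq xz => <-; rewrite sedge_irr.
have mu12 : mu = 1 \/ mu = 2 by rewrite -(cn_nonadj _ _ xw nxw); apply: cn.
have lt_partners := partners_lt G_deza x isT.
have gt_partners := partners_gt0 G_deza x isT.
(* Equal values of [l] and [mu] would leave just one number of common neighbours. If [l = 1] and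
   [mu = 2], the partners are the [v - 5] non-neighbours and the count gives [v = 9]; a search
   excludes [l = 2] and [mu = 1]. *)
case: l12 mu12 => l_eq [] mu_eq;
  rewrite {}l_eq {}mu_eq in cn_adj cn_nonadj partnersE.
- have p0 : #|partners 2 x| = 0.
    by apply: eq_card0 => y; rewrite partnersE if_same andbF.
  by rewrite p0 in gt_partners.
- have p_nonadj : #|partners 2 x| = v - 5.
    rewrite -card_nonadj; apply: eq_card => y; rewrite partnersE !inE negb_or.
    by case: (sedge x y).
  have v9 : v = 9 by move: count; rewrite p_nonadj; lia.
  case/negP: nsrg; rewrite v9 eqxx /=; apply/forallP => y; apply/forallP => z'.
  apply/implyP => yz; case eyz: (sedge y z'); first by rewrite cn_adj.
  by rewrite cn_nonadj ?eyz.
- apply: (@search_no_leaf 4 [:: 2] [:: 1] 20 G x reg); last by vm_compute.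
  move=> y z' yz; case eyz: (sedge y z'); first by rewrite cn_adj.
  by rewrite cn_nonadj ?eyz.
- have : #|partners 2 x| = v.-1.
    rewrite -cardG -(cardC1 x); apply: eq_card => y.
    by rewrite partnersE if_same andbT.
  by move=> p_all; rewrite p_all ltnn in lt_partners.
Qed.

Lemma deza_gap3 (G : sgraph) (v a : nat) :
  connected G -> deza G v (a + 3) (a + 1) a ->
  [\/ strictly_deza G 8 4 2 1 \/ strictly_deza G 9 4 2 1,
      [\/ strongly_regular G 9 4 1 2,
          strongly_regular G 10 3 0 1
        | strongly_regular G 10 6 3 4]
    | deza G v 3 1 0 /\ 2 < diameter G].
Proof.
move=> conn G_deza.
have [x _] := deza_inhabited G_deza.
have reg := deza_regular G_deza; have cardG := deza_card G_deza.
have [e v_e] : exists e, v = a + 3 + (e + 4).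
  by apply: deza_card_ge G_deza _; lia.
have cardGe : #|G| = a + 3 + (e + 4) by rewrite cardG.
have count y := deza_gap3_excess y G_deza v_e.
have gt0 : 0 < #|partners (a + 1) x| by apply: (partners_gt0 G_deza x); lia.
have [a0|a1|a2|a_ge3] : [\/ a = 0, a = 1, a = 2 | 3 <= a].
  case: (a) => [|[|[|a']]];
    by [apply: Or41 | apply: Or42 | apply: Or43 | apply: Or44].
- rewrite {}a0 in G_deza.
  have [diam|srg] := deza_k3 G_deza conn; first exact: Or33.
  exact/Or32/Or32.
- rewrite {}a1 in G_deza.
  have [strict|srg] := deza_k4 G_deza conn; first exact: Or31.
  exact/Or32/Or31.
- rewrite {}a2 in G_deza reg.
  have cn y z := deza_codegrees (x := y) (y := z) G_deza.
  by exfalso; apply: (@search_no_leaf 5 _ _ 20 G x reg cn); vm_compute.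
(* If [e >= 1], then [(e + 1) * a >= 6] leaves no partners. *)
have e0 : e = 0 by have := count x; nia.
rewrite {}e0 in cardGe count.
have [_ _ cn _ _] := G_deza.
(* Adjacent vertices of the complement with only [a] common neighbours in [G] would have -1 of them
   there. *)
have nonadj_sub (y : G) :
    neighbors (y : complement G) \subset partners (a + 1) y.
  apply/subsetP => z; rewrite !inE => /andP[yz nyz].
  have := complement_common_neighbors reg cardGe yz; rewrite nyz.
  by rewrite eq_sym yz; case: (cn y z yz) => ->; lia.
have card_nonadj (y : G) : #|neighbors (y : complement G)| = 3.
  exact: (complement_regular reg cardGe).
(* The 3 non-neighbours are among the [6 - a] partners. *)
have a3 : a = 3.
  have : 3 <= #|partners (a + 1) x|.
    by rewrite -(card_nonadj x); apply: subset_leq_card (nonadj_sub x).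
  by have := count x; lia.
have nonadjE (y : G) : neighbors (y : complement G) = partners (a + 1) y.
  apply/eqP; rewrite eqEcard nonadj_sub card_nonadj.
  suff : #|partners (a + 1) y| <= 3 by [].
  by have := count y; lia.
rewrite {}a3 in cardGe reg cn nonadjE.
apply/Or32/Or33; split; [exact: cardGe | exact: reg | |] => y z.
  move=> yz; have yz' : y != z by apply: contraTneq yz => <-; rewrite sedge_irr.
  case: (cn y z yz') => // cyz.
  have : z \in partners 4 y by rewrite inE eq_sym yz' cyz eqxx.
  by rewrite -(nonadjE y) inE /= /compl_edge yz andbF.
move=> yz nyz; have : z \in neighbors (y : complement G).
  by rewrite inE /= /compl_edge yz.
by rewrite nonadjE inE => /andP[_ /eqP].
Qed.

(** * Assembly of the classification *)

Theorem theorem2 (G : sgraph) (v k b a : nat)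
    (G_connected : connected G)
    (G_deza : deza G v k b a)
    (k_b2 : k = b + 2) :
  [/\ (k = a + 3 \/ k = a + 4) \/ is_divisible_design G,
      (k = a + 3 ->
        [\/ strictly_deza G 8 4 2 1 \/ strictly_deza G 9 4 2 1,
            [\/ strongly_regular G 9 4 1 2,
                strongly_regular G 10 3 0 1
              | strongly_regular G 10 6 3 4]
          | deza G v 3 1 0 /\ 2 < diameter G])
    & (k = a + 4 ->
        [\/ exists s : nat,
              [/\ 0 < s,
                  isomorphic G (complement (copies s (hypercube 3)))
                & deza G (8 * s) (8 * (s - 1) + 4) (8 * (s - 1) + 2)
                    (8 * (s - 1))],
            deza G 14 4 2 0 /\ isomorphic G fano_nonincidence
          | isomorphic G (hypercube 4) /\ deza G 16 4 2 0])].
Proof.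
have le_ab : a <= b by case: G_deza.
split=> [|k_a|k_a].
- have [->|] := eqVneq k (a + 3); first by left; left.
  have [->|] := eqVneq k (a + 4); first by left; right.
  move=> k_neq4 k_neq3; right.
  have [eq_ab|neq_ab] := eqVneq a b.
    exact: deza_const_divisible G_deza eq_ab.
  (* As [b = k - 2], the gap condition says [k > a + 4]. *)
  by apply: deza_gap_divisible G_deza _; lia.
- have b_a : b = a + 1 by lia.
  by move: G_deza; rewrite k_a b_a; apply: deza_gap3.
- have b_a : b = a + 2 by lia.
  by move: G_deza; rewrite k_a b_a; apply: deza_gap4.
Qed.
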